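(* Let $X$ be a sequentially complete Fréchet space and $1\le p<+\infty$. Then the space $\mathcal{U}^p([a,b];X)$ is a sequentially complete Fréchet space.
   Context: $[a,b]$ is a compact interval. A locally convex space is a vector space with a topology generated by semi-norms for which there is a separating family of continuous semi-norms. A Fréchet space, here and for every space in the claim, is a locally convex space whose topology can be generated by a countable collection of continuous semi-norms. Completeness is not part of this definition. A locally convex space is sequentially complete if every sequence that is Cauchy with respect to each continuous semi-norm converges to some element of the space. Let $\mathcal{P}=\{\rho_i:i\in\mathbb{N}\}$ be a countable separating family of continuous semi-norms generating the topology of $X$. A gauge on $[a,b]$ is a function $\delta:[a,b]\to(0,\infty)$. A tagged partition of $[a,b]$ is a finite collection $D=\{([u_i,v_i],t_i):1\le i\le n\}$ of non-overlapping non-degenerate closed intervals with union $[a,b]$ and tags $t_i\in[u_i,v_i]$. It is $\delta$-fine if $[u_i,v_i]\subseteq(t_i-\delta(t_i),t_i+\delta(t_i))$ for every $i$. For such $D$, $(D)\sum\varphi(t)(v-u)$ denotes $\sum_{i=1}^n\varphi(t_i)(v_i-u_i)$. For a semi-norm $\rho$ on $X$, a function $f:[a,b]\to X$ and $1\le p<\infty$, put $$\mu^p_\rho(f,[a,b])=\inf_{\text{gauge }\delta}\ \sup\Big\{(D)\sum \rho(f(t))^p\,(v-u): D\text{ is a }\delta\text{-fine tagged partition of }[a,b]\Big\}\in[0,\infty],$$ and $\|f\|_{\mathcal{U}^p_\rho}=\mu^p_\rho(f,[a,b])^{1/p}$. $\mathcal{U}^p([a,b];X)$ is the space of all functions $f:[a,b]\to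 X$ with $\mu^p_\rho(f,[a,b])<\infty$ for every continuous semi-norm $\rho$ on $X$, with the topology given by the countable collection of semi-norms $\{\|\cdot\|_{\mathcal{U}^p_{\rho_i}}:i\in\mathbb{N}\}$.
   Formalization: Functions whose difference has all semi-norms zero are identified: U^p([a,b];X) is replaced by its Hausdorff quotient, since a nonzero function supported at one point has all semi-norms 0, so the literal function space is not separated. Scalars are real. *)

(* Defs.v *)
From HB Require Import structures.
From mathcomp Require Import all_boot all_order all_algebra.
From mathcomp Require Import all_classical all_reals all_analysis.
From mathcomp Require Import ring lra.

Set Implicit Arguments.
Unset Strict Implicit.
Unset Printing Implicit Defensive.

Import Order.TTheory GRing.Theory Num.Theory.
Import numFieldTopology.Exports numFieldNormedType.Exports.

Local Open Scope classical_set_scope.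
Local Open Scope ring_scope.

Section Seminorms.
Context {R : realType}.

Definition seminorm (V : lmodType R) (q : V -> R) : Prop :=
  [/\ forall x, 0 <= q x,
      forall x y, q (x + y) <= q x + q y &
      forall (c : R) x, q (c *: x) = `|c| * q x].

(* The topology generated by a family [P] of semi-norms, given by its open
   sets: finite intersections of [P]-balls of a common radius around [x] form
   a neighbourhood base at [x]. *)
Definition seminorm_open (V : lmodType R) (P : set (V -> R)) : set_system V :=
  [set U | forall x, U x -> exists (F : set (V -> R)) (e : R),
    [/\ finite_set F, F `<=` P, 0 < e &
        [set y | forall q, F q -> q (y - x) < e] `<=` U]].

Definition separating (V : lmodType R) (P : set (V -> R)) : Prop :=
  forall x, x != 0 -> exists2 q, P q & q x != 0.

(* No compatibility between the topology and the vector space structure is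
   presupposed by [preTopologicalLmodType]: it follows from [generates]. *)
Definition continuous_seminorm (X : preTopologicalLmodType R) (q : X -> R) :
  Prop := seminorm q /\ continuous q.

Definition generates (X : preTopologicalLmodType R) (P : set (X -> R)) : Prop :=
  open = seminorm_open P.

Definition locally_convex_space (X : preTopologicalLmodType R) : Prop :=
  (exists2 P : set (X -> R), P `<=` @seminorm X & generates P) /\
  (exists2 P : set (X -> R), P `<=` @continuous_seminorm X & separating P).

Definition frechet_space (X : preTopologicalLmodType R) : Prop :=
  locally_convex_space X /\
  (exists P : set (X -> R),
    [/\ countable P, P `<=` @continuous_seminorm X & generates P]).

Definition seminorm_cauchy (V : lmodType R) (q : V -> R) (u : nat -> V) :
  Prop := forall e : R, 0 < e ->
    exists N : nat, forall m n, (N <= m)%N -> (N <= n)%N -> q (u m - u n) < e.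

Definition sequentially_complete (X : preTopologicalLmodType R) : Prop :=
  forall u : nat -> X,
    (forall q, continuous_seminorm q -> seminorm_cauchy q u) ->
    exists x : X, u @ \oo --> x.

Definition fundamental_seminorms (X : preTopologicalLmodType R)
    (rho : nat -> X -> R) : Prop :=
  [/\ forall i, continuous_seminorm (rho i), separating (range rho) &
      generates (range rho)].

End Seminorms.

Section TaggedPartitions.
Context {R : realType}.
Variables a b : R.

Definition cinterval : Type := set_type `[a, b]%classic.

Record tagged_partition := TaggedPartition {
  tp_size : nat;
  tp_left : 'I_tp_size -> R;
  tp_right : 'I_tp_size -> R;
  tp_tag : 'I_tp_size -> cinterval;
  tp_nondegenerate : forall i, tp_left i < tp_right i;
  tp_nonoverlapping : forall i j, i != j ->
    `]tp_left i, tp_right i[%classic `&` `]tp_left j, tp_right j[%classic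
      = set0;
  tp_cover :
    \bigcup_(i in [set: 'I_tp_size]) `[tp_left i, tp_right i]%classic
      = `[a, b]%classic;
  tp_tag_in : forall i, `[tp_left i, tp_right i]%classic (\val (tp_tag i))
}.

Definition gauge (delta : cinterval -> R) : Prop := forall t, 0 < delta t.

Definition fine_partition (delta : cinterval -> R) (D : tagged_partition) :
  Prop :=
  forall i : 'I_(tp_size D), `[tp_left i, tp_right i]%classic `<=`
    `](\val (tp_tag i) - delta (tp_tag i)),
      (\val (tp_tag i) + delta (tp_tag i))[%classic.

Definition partition_sum (phi : cinterval -> R) (D : tagged_partition) : R :=
  \sum_(i < tp_size D) phi (tp_tag i) * (tp_right i - tp_left i).

(* On a non-degenerate interval every gauge admits a fine partition, so each
   supremum, and hence the infimum, lies in [0, +oo]. *)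
Definition upper_pmean (X : Type) (q : X -> R) (p : R) (f : cinterval -> X) :
  \bar R :=
  ereal_inf [set ereal_sup
    [set (partition_sum (fun t => q (f t) `^ p) D)%:E |
       D in fine_partition delta] | delta in gauge].

(* [fine] is only meaningful when [upper_pmean q p f] is finite, which is the
   case for [f] in the function space below. *)
Definition Upnorm (X : Type) (q : X -> R) (p : R) (f : cinterval -> X) : R :=
  fine (upper_pmean q p f) `^ p^-1.

End TaggedPartitions.

Section UpperMeanTheory.
Context {R : realType}.
Variables (a b p : R) (p1 : 1 <= p).

Let p0 : 0 < p. Proof. exact: lt_le_trans p1. Qed.

Lemma partition_sum_ge0 (phi : cinterval a b -> R) D :
  (forall t, 0 <= phi t) -> 0 <= partition_sum phi D.
Proof.
move=> phi0; apply: sumr_ge0 => i _.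
by rewrite mulr_ge0// subr_ge0 ltW// tp_nondegenerate.
Qed.

Lemma ler_partition_sum (phi psi : cinterval a b -> R) D :
  (forall t, phi t <= psi t) -> partition_sum phi D <= partition_sum psi D.
Proof.
move=> le_phi; apply: ler_sum => i _.
by rewrite ler_wpM2r// subr_ge0 ltW// tp_nondegenerate.
Qed.

Lemma partition_sumD (phi psi : cinterval a b -> R) D :
  partition_sum (fun t => phi t + psi t) D =
  partition_sum phi D + partition_sum psi D.
Proof.
by rewrite -big_split/=; apply: eq_bigr => i _; rewrite mulrDl.
Qed.

Lemma partition_sumZ (c : R) (phi : cinterval a b -> R) D :
  partition_sum (fun t => c * phi t) D = c * partition_sum phi D.
Proof.
by rewrite /partition_sum mulr_sumr; apply: eq_bigr => i _; rewrite mulrA.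
Qed.

Lemma fine_partition_min (d1 d2 : cinterval a b -> R) D :
  fine_partition (fun t => Num.min (d1 t) (d2 t)) D ->
  fine_partition d1 D /\ fine_partition d2 D.
Proof.
move=> fD; split=> i x xD; have /= := fD i x xD; rewrite !in_itv/= => /andP[lx xl].
  apply/andP; split.
    by apply: le_lt_trans lx; rewrite lerD2l lerN2 ge_min lexx.
  by apply: lt_le_trans xl _; rewrite lerD2l ge_min lexx.
apply/andP; split.
  by apply: le_lt_trans lx; rewrite lerD2l lerN2 ge_min lexx orbT.
by apply: lt_le_trans xl _; rewrite lerD2l ge_min lexx orbT.
Qed.

Definition pmean_bounded (X : Type) (q : X -> R) (f : cinterval a b -> X)
    (C : R) : Prop :=
  exists2 delta, gauge delta & forall D, fine_partition delta D ->
    partition_sum (fun t => q (f t) `^ p) D <= C.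

Section OneFunction.
Variables (X : Type) (q : X -> R) (f : cinterval a b -> X).

Lemma upper_pmean_bounded C :
  (upper_pmean q p f < C%:E)%E -> pmean_bounded q f C.
Proof.
move=> /ereal_inf_lt[_ [delta gd <-]] supC; exists delta => // D fD.
rewrite -lee_fin; apply: le_trans (ltW supC).
by apply: ereal_sup_ubound; exists D.
Qed.

Lemma bounded_upper_pmean C :
  pmean_bounded q f C -> (upper_pmean q p f <= C%:E)%E.
Proof.
move=> [delta gd bd].
apply: (@le_trans _ _ (ereal_sup
    [set (partition_sum (fun t => q (f t) `^ p) D)%:E |
       D in fine_partition delta])).
  by apply: ereal_inf_lbound; exists delta.
by apply: ge_ereal_sup => _ [D fD <-]; rewrite lee_fin; exact: bd.
Qed.

Lemma upper_pmean_ge0 :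
  upper_pmean q p f = -oo%E \/ (0 <= upper_pmean q p f)%E.
Proof.
have [lt0|] := ltP (upper_pmean q p f) 0%E; [left|by right].
have [_ [delta gd <-] sup0] := ereal_inf_lt lt0.
have noD D : ~ fine_partition delta D.
  move=> fD; move: sup0; apply/negP; rewrite -leNgt.
  apply: (@le_trans _ _ (partition_sum (fun t => q (f t) `^ p) D)%:E).
    by rewrite lee_fin partition_sum_ge0// => t; exact: powR_ge0.
  by apply: ereal_sup_ubound; exists D.
apply/eqP; rewrite -leeNy_eq.
apply: (@le_trans _ _ (ereal_sup
    [set (partition_sum (fun t => q (f t) `^ p) D)%:E |
       D in fine_partition delta])).
  by apply: ereal_inf_lbound; exists delta.
by apply: ge_ereal_sup => x [D fD _]; case: (noD D fD).
Qed.

Lemma fine_upper_pmean_ge0 : 0 <= fine (upper_pmean q p f).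
Proof. by have [->//|/fine_ge0] := upper_pmean_ge0. Qed.

Lemma Upnorm_ge0 : 0 <= Upnorm q p f.
Proof. exact: powR_ge0. Qed.

Lemma Upnorm_bounded A : (upper_pmean q p f < +oo)%E ->
  Upnorm q p f < A -> pmean_bounded q f (A `^ p).
Proof.
move=> fin nA; have A0 : 0 < A by exact: le_lt_trans Upnorm_ge0 nA.
apply: upper_pmean_bounded.
have : fine (upper_pmean q p f) < A `^ p.
  rewrite -[ltLHS]powRr1 ?fine_upper_pmean_ge0// -[in ltLHS](mulVf (lt0r_neq0 p0)).
  rewrite powRrM; apply: gt0_ltr_powR => //.
    by rewrite nnegrE Upnorm_ge0.
  by rewrite nnegrE ltW.
case: (upper_pmean q p f) fin => [r||]//= _ _.
exact: ltNyr.
Qed.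

Lemma bounded_Upnorm C : 0 <= C -> pmean_bounded q f (C `^ p) ->
  (upper_pmean q p f < +oo)%E /\ Upnorm q p f <= C.
Proof.
move=> C0 /bounded_upper_pmean bd; split; first exact: le_lt_trans bd (ltry _).
rewrite /Upnorm -[leRHS]powRr1// -(mulfV (lt0r_neq0 p0)) powRrM.
apply: ge0_ler_powR; rewrite ?invr_ge0 ?(ltW p0)// ?nnegrE.
- exact: fine_upper_pmean_ge0.
- exact: powR_ge0.
have := bd; case: (upper_pmean q p f) => [r||]//= _.
exact: powR_ge0.
Qed.

End OneFunction.

Lemma powR_minkowski (x y A B : R) : 0 <= x -> 0 <= y -> 0 < A -> 0 < B ->
  (x + y) `^ p <= (A + B) `^ p *
    (A / (A + B) * (x / A) `^ p + B / (A + B) * (y / B) `^ p).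
Proof.
move=> x0 y0 A0 B0.
have AB0 : 0 < A + B by rewrite addr_gt0.
have t01 : 0 <= A / (A + B) <= 1.
  by rewrite divr_ge0 ?(ltW A0, ltW AB0)//= ler_pdivrMr// mul1r lerDl ltW.
have /andP[t0 t1] := t01.
have := @convex_powR R p p1 (Itv01 t0 t1) (x / A) (y / B).
rewrite !inE/= !in_itv/= !andbT !divr_ge0 ?(ltW A0) ?(ltW B0)// => /(_ isT isT).
rewrite [X in X `^ _]convRE [X in _ <= X -> _]convRE/=.
have -> : unstable.onem (A / (A + B)) = B / (A + B).
  by rewrite /unstable.onem -[X in X - _](mulfV (lt0r_neq0 AB0)) -mulrBl addrAC subrr add0r.
move=> H.
have -> : x + y = (A + B) * (A / (A + B) * (x / A) + B / (A + B) * (y / B)).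
  by field; rewrite !gt_eqF.
rewrite powRM ?(ltW AB0)//.
  by rewrite ler_wpM2l ?powR_ge0.
by rewrite addr_ge0// mulr_ge0// divr_ge0// ltW.
Qed.

Variables (X : lmodType R) (q : X -> R) (sq : seminorm q).
Implicit Types f g : cinterval a b -> X.

Lemma pmean_boundedD f g A B : 0 < A -> 0 < B ->
  pmean_bounded q f (A `^ p) -> pmean_bounded q g (B `^ p) ->
  pmean_bounded q (f + g) ((A + B) `^ p).
Proof.
case: sq => q0 qD _ A0 B0 [d1 gd1 bf] [d2 gd2 bg].
exists (fun t => Num.min (d1 t) (d2 t)) => [t|D].
  by rewrite lt_min gd1 gd2.
move=> /fine_partition_min[/bf bfD /bg bgD].
have AB0 : 0 < A + B by rewrite addr_gt0.
pose K := (A + B) `^ p.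
apply: (@le_trans _ _ (partition_sum (fun t =>
    K * (A / (A + B) / A `^ p) * q (f t) `^ p +
    K * (B / (A + B) / B `^ p) * q (g t) `^ p) D)).
  apply: ler_partition_sum => t.
  apply: (@le_trans _ _ ((q (f t) + q (g t)) `^ p)).
    by apply: ge0_ler_powR; rewrite ?(ltW p0)// ?nnegrE ?addr_ge0//; exact: qD.
  apply: le_trans (powR_minkowski (q0 _) (q0 _) A0 B0) _.
  rewrite !powRM ?invr_ge0 ?(ltW A0) ?(ltW B0)//.
  have powRV c : 0 < c -> c^-1 `^ p = (c `^ p)^-1.
    by move=> c0; rewrite -!powR_inv1 ?(ltW c0) ?powR_ge0// powRAC.
  rewrite !powRV// /K.
  by rewrite le_eqVlt; apply/orP; left; apply/eqP; ring.
rewrite partition_sumD !partition_sumZ.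
apply: (@le_trans _ _ (K * (A / (A + B)) + K * (B / (A + B)))).
  have H (c s t : R) : 0 <= c -> 0 < t -> s <= t -> K * (c / t) * s <= K * c.
    move=> c0 t0 st; rewrite -mulrA ler_wpM2l ?powR_ge0//.
    by rewrite -mulrA ler_piMr// mulrC ler_pdivrMr// mul1r.
  by apply: lerD; apply: H => //; rewrite ?powR_gt0// divr_ge0// ltW.
by rewrite -mulrDr -mulrDl mulfV ?gt_eqF// mulr1.
Qed.

Lemma pmean_boundedZ c f A : 0 <= A ->
  pmean_bounded q f (A `^ p) -> pmean_bounded q (c *: f) ((`|c| * A) `^ p).
Proof.
case: sq => q0 _ qZ A0 [d gd bf]; exists d => // D /bf bfD.
apply: (@le_trans _ _
    (partition_sum (fun t => `|c| `^ p * q (f t) `^ p) D)).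
  by apply: ler_partition_sum => t; rewrite /= qZ powRM.
by rewrite partition_sumZ powRM// ler_wpM2l// powR_ge0.
Qed.

Lemma UpnormD f g :
  (upper_pmean q p f < +oo)%E -> (upper_pmean q p g < +oo)%E ->
  (upper_pmean q p (f + g)%R < +oo)%E /\
  Upnorm q p (f + g) <= Upnorm q p f + Upnorm q p g.
Proof.
move=> ff fg.
have H (e : R) : 0 < e -> (upper_pmean q p (f + g)%R < +oo)%E /\
    Upnorm q p (f + g) <= (Upnorm q p f + e) + (Upnorm q p g + e).
  move=> e0.
  have bnd (h : cinterval a b -> X) : (upper_pmean q p h < +oo)%E ->
      pmean_bounded q h ((Upnorm q p h + e) `^ p).
    by move=> fh; apply: Upnorm_bounded => //; rewrite ltrDl.
  have pos (h : cinterval a b -> X) : 0 < Upnorm q p h + e.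
    by apply: ltr_wpDl => //; exact: Upnorm_ge0.
  apply: bounded_Upnorm; first by rewrite addr_ge0// ltW.
  by apply: pmean_boundedD => //; exact: bnd.
split; first by have [] := H 1 ltr01.
apply/ler_addgt0Pr => e e0; have [_] := H (e / 2) (divr_gt0 e0 (ltr0Sn _ 1)).
by move/le_trans; apply; rewrite addrACA -splitr.
Qed.

Lemma UpnormZ_le c f : (upper_pmean q p f < +oo)%E ->
  (upper_pmean q p (c *: f)%R < +oo)%E /\
  Upnorm q p (c *: f) <= `|c| * Upnorm q p f.
Proof.
move=> ff.
have H (e : R) : 0 < e -> (upper_pmean q p (c *: f)%R < +oo)%E /\
    Upnorm q p (c *: f) <= `|c| * (Upnorm q p f + e).
  move=> e0; apply: bounded_Upnorm.
    by rewrite mulr_ge0// addr_ge0 ?Upnorm_ge0// ltW.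
  apply: pmean_boundedZ; first by rewrite addr_ge0 ?Upnorm_ge0// ltW.
  by apply: Upnorm_bounded => //; rewrite ltrDl.
split; first by have [] := H 1 ltr01.
apply/ler_addgt0Pr => e e0.
have c1 : 0 < `|c| + 1 by rewrite ltr_wpDl.
have [_] := H (e / (`|c| + 1)) (divr_gt0 e0 c1).
move/le_trans; apply; rewrite mulrDr lerD2l mulrA ler_pdivrMr//.
by rewrite mulrC ler_pM2l// lerDl.
Qed.

Lemma Upnorm_cst0 : (upper_pmean q p (0%R : cinterval a b -> X) < +oo)%E /\
  Upnorm q p (0 : cinterval a b -> X) = 0.
Proof.
have q00 : q 0 = 0 by case: sq => _ _ qZ; rewrite -(scale0r 0) qZ normr0 mul0r.
have [||fin le0] := @bounded_Upnorm X q (0 : cinterval a b -> X) 0 => //.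
  exists (fun=> 1) => // D _; rewrite powR0 ?gt_eqF//.
  by rewrite /partition_sum big1// => i _; rewrite /= q00 powR0 ?gt_eqF// mul0r.
by split=> //; apply/eqP; rewrite eq_le le0 Upnorm_ge0.
Qed.

End UpperMeanTheory.

Section SeminormTopology.
Context {R : realType} (V : lmodType R) (P : set (V -> R)).

Lemma seminorm_openT : seminorm_open P setT.
Proof. by move=> x _; exists set0, 1; split. Qed.

Lemma seminorm_openI : setI_closed (seminorm_open P).
Proof.
move=> U W oU oW x [/oU[F [e [finF FP e0 FU]]] /oW[G [d [finG GP d0 GW]]]].
exists (F `|` G), (Num.min e d); split.
- by rewrite finite_setU.
- by rewrite subUset.
- by rewrite lt_min e0 d0.
- move=> y /= ymin; split.
    apply: FU => q Fq /=; have := ymin q (or_introl Fq).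
    by rewrite lt_min => /andP[].
  apply: GW => q Gq /=; have := ymin q (or_intror Gq).
  by rewrite lt_min => /andP[].
Qed.

Lemma seminorm_open_bigcup (I : Type) (U : I -> set V) :
  (forall i, seminorm_open P (U i)) -> seminorm_open P (\bigcup_i U i).
Proof.
move=> oU x [i _ /oU[F [e [finF FP e0 FU]]]]; exists F, e; split => // y /FU.
by exists i.
Qed.

End SeminormTopology.

Section FunctionSpace.
Context {R : realType}.
Variables (a b : R) (X : preTopologicalLmodType R) (p : R).

(* The proof of [1 <= p] is an argument only so that the closure of the
   predicate under the vector space operations can be attached to it. *)
Definition Upfinite (_ : 1 <= p) : {pred cinterval a b -> X} :=
  [pred f | `[< forall q : X -> R, continuous_seminorm q ->
                  (upper_pmean q p f < +oo)%E >]].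

Variable p1 : 1 <= p.

Lemma Upfinite_submod_closed : submod_closed (Upfinite p1).
Proof.
split=> [|c f g /asboolP ff /asboolP fg]; apply/asboolP => q cq.
  by have [] := Upnorm_cst0 a b p1 cq.1.
by have [] := UpnormD p1 cq.1 (UpnormZ_le p1 cq.1 c (ff q cq)).1 (fg q cq).
Qed.

HB.instance Definition _ :=
  GRing.isSubmodClosed.Build _ _ (Upfinite p1) Upfinite_submod_closed.

Record Upfun := UpFun {
  upfun_val :> cinterval a b -> X;
  upfunP : upfun_val \in Upfinite p1
}.

HB.instance Definition _ := [isSub for upfun_val].
HB.instance Definition _ := [Choice of Upfun by <:].
HB.instance Definition _ := [SubChoice_isSubLmodule of Upfun by <:].

Lemma upfun_finite (f : Upfun) (q : X -> R) :
  continuous_seminorm q -> (upper_pmean q p f < +oo)%E.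
Proof. by move=> cq; have /asboolP := upfunP f; exact. Qed.

End FunctionSpace.

(* Functions on which all the defining semi-norms vanish (for [a < b], those
   that are zero almost everywhere) are identified with [0]: otherwise the
   semi-norms would not separate points. *)
Section UpSpace.
Context {R : realType}.
Variables (a b : R) (X : preTopologicalLmodType R) (p : R).
Variables (rho : nat -> X -> R) (rhoP : fundamental_seminorms rho).
Variable p1 : 1 <= p.

Let rho_continuous i : continuous_seminorm (rho i).
Proof. by case: rhoP. Qed.

Definition Upnull (_ : fundamental_seminorms rho) : {pred Upfun a b X p1} :=
  [pred f : Upfun a b X p1 | `[< forall i, Upnorm (rho i) p f = 0 >]].

Lemma Upnull_submod_closed : submod_closed (Upnull rhoP).
Proof.
split=> [|c f g /asboolP f0 /asboolP g0]; apply/asboolP => i.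
  by have [] := Upnorm_cst0 a b p1 (rho_continuous i).1.
have [cf cf0] :=
  UpnormZ_le p1 (rho_continuous i).1 c (upfun_finite f (rho_continuous i)).
have [_] := UpnormD p1 (rho_continuous i).1 cf
  (upfun_finite g (rho_continuous i)).
rewrite g0 addr0 => /le_trans /(_ cf0); rewrite f0 mulr0 => le0.
by apply/eqP; rewrite eq_le le0 Upnorm_ge0.
Qed.

HB.instance Definition _ :=
  GRing.isSubmodClosed.Build _ _ (Upnull rhoP) Upnull_submod_closed.

Definition Upspace : Type := Quotient.quot (Upnull rhoP).

HB.instance Definition _ := GRing.Zmodule.on Upspace.
HB.instance Definition _ := Quotient.on Upspace.

Local Open Scope quotient_scope.

Definition Upclass (f : Upfun a b X p1) : Upspace := \pi_Upspace f.

Lemma Upclass_eqP f g : reflect (Upclass f = Upclass g) (f - g \in Upnull rhoP).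
Proof.
by rewrite (Quotient.idealrBE (Upnull rhoP)); exact: eqP.
Qed.

Lemma UpclassD f g : Upclass (f + g) = Upclass f + Upclass g.
Proof. exact: (raddfD \pi_(Quotient.quot (Upnull rhoP))). Qed.

Lemma repr_UpclassK f : f - repr (Upclass f) \in Upnull rhoP.
Proof. by apply/Upclass_eqP; rewrite /Upclass reprK. Qed.

Definition Upscale (c : R) (x : Upspace) : Upspace := Upclass (c *: repr x).

Lemma UpclassZ c f : Upclass (c *: f) = Upscale c (Upclass f).
Proof. by apply/Upclass_eqP; rewrite -scalerBr rpredZ// repr_UpclassK. Qed.

Lemma Upclass_surj x : exists f, x = Upclass f.
Proof. by exists (repr x); rewrite /Upclass reprK. Qed.

Lemma UpscaleA c d x : Upscale c (Upscale d x) = Upscale (c * d) x.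
Proof. by have [f ->] := Upclass_surj x; rewrite -!UpclassZ scalerA. Qed.

Lemma Upscale1 : left_id 1 Upscale.
Proof.
by move=> x; have [f ->] := Upclass_surj x; rewrite -!UpclassZ scale1r.
Qed.

Lemma UpscaleDr : right_distributive Upscale +%R.
Proof.
move=> c x y; have [f ->] := Upclass_surj x; have [g ->] := Upclass_surj y.
by rewrite -UpclassD -!UpclassZ scalerDr UpclassD.
Qed.

Lemma UpscaleDl x : {morph Upscale^~ x : c d / c + d}.
Proof.
move=> c d; have [f ->] := Upclass_surj x.
by rewrite -!UpclassZ scalerDl UpclassD.
Qed.

HB.instance Definition _ := GRing.Zmodule_isLmodule.Build R Upspace
  UpscaleA Upscale1 UpscaleDr UpscaleDl.

(* Independent of the representative, by [Upspace_normE]. *)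
Definition Upspace_norm (i : nat) (x : Upspace) : R :=
  Upnorm (rho i) p (repr x).

Lemma Upspace_normE i (f : Upfun a b X p1) :
  Upspace_norm i (Upclass f) = Upnorm (rho i) p f.
Proof.
have fg := repr_UpclassK f; rewrite /Upspace_norm.
move: (repr (Upclass f)) fg => g fg.
have gf : g - f \in Upnull rhoP by rewrite -opprB rpredN.
have le (h k : Upfun a b X p1) : h - k \in Upnull rhoP ->
    Upnorm (rho i) p h <= Upnorm (rho i) p k.
  move=> /asboolP/(_ i) hk0; have [_] := UpnormD p1 (rho_continuous i).1
    (upfun_finite (h - k) (rho_continuous i))
    (upfun_finite k (rho_continuous i)).
  have -> : upfun_val (h - k) + k = h.
    by rewrite -[RHS]/(\val h) -[in RHS](subrK k h) raddfD.
  by rewrite hk0 add0r.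
by apply: le_anti; apply/andP; split; [exact: (le _ _ gf)|
  exact: (le _ _ fg)].
Qed.

(* The open sets of [Upspace] are those of [seminorm_open] for the countable
   family [Upspace_norm]. *)
HB.instance Definition _ := isOpenTopological.Build Upspace
  (seminorm_openT (range Upspace_norm))
  (@seminorm_openI _ _ (range Upspace_norm))
  (@seminorm_open_bigcup _ _ (range Upspace_norm)).

End UpSpace.

(* Main.v *)
Require Import Defs.
From mathcomp Require Import all_boot all_order all_algebra.
From mathcomp Require Import all_classical all_reals all_analysis.
From mathcomp Require Import ring lra.

(* Let [F k] be representatives of a subsequence of a Cauchy sequence, with
   increments small enough for [rho 0], ..., [rho k]. Put [f t] = lim [F k t] if
   this limit exists and [f t] = 0 otherwise. If [i <= m], then for every [t]
   there are [k >= m] and [j <= k] with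
     rho i (f t - F m t) <= 2 ^ (k + 2) * rho j (F (k + 1) t - F k t),
   since otherwise the increments would be dominated by a geometric sequence.
   The gauge that uses at [t] the gauge of the increment so selected bounds the
   sums of [rho i (f - F m) ^ p]: in a fine partition, the intervals whose tags
   select the [k]-th increment are completed by Cousin's lemma to a partition
   that is fine for the [k]-th gauge, and the bounds are summable in [k]. *)

Import Order.TTheory GRing.Theory Num.Theory.
Import numFieldTopology.Exports numFieldNormedType.Exports.

Local Open Scope classical_set_scope.
Local Open Scope ring_scope.

Set Implicit Arguments.
Unset Strict Implicit.
Unset Printing Implicit Defensive.

(** * Tagged partitions: gluing, refinement and Cousin's lemma *)

Section Partitions.
Context {R : realType}.
Implicit Types (a b c d : R) (g phi : R -> R).

(** Arbitrary finite index types let sum types and dependent pairs index glued partitions. Tags,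
    gauges and integrands are taken on the real line because [cinterval c d] changes with the
    interval, while one gauge has to serve on all subintervals. *)
Lemma family_partition c d (I : finType) (l r t : I -> R) :
  (forall i, l i < r i) ->
  (forall i j, i != j -> `]l i, r i[ `&` `]l j, r j[ = set0) ->
  \bigcup_i `[l i, r i]%classic = `[c, d]%classic ->
  (forall i, `[l i, r i]%classic (t i)) ->
  exists D : tagged_partition c d,
    (forall g,
       (forall i, `[l i, r i] `<=` `](t i - g (t i)), (t i + g (t i))[) ->
       fine_partition (fun x => g (\val x)) D) /\
    (forall phi, partition_sum (fun x => phi (\val x)) D =
       \sum_i phi (t i) * (r i - l i)).
Proof.
move=> lr dis cov tin.
have tcd i : t i \in `[c, d]%classic.
  by rewrite inE -cov; exists i => //; exact: tin.
have cov' : \bigcup_(i in [set: 'I_#|I|])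
    `[l (enum_val i), r (enum_val i)]%classic = `[c, d]%classic.
  rewrite -cov; apply/seteqP; split=> x [i _ xi].
    by exists (enum_val i).
  by exists (enum_rank i) => //; rewrite enum_rankK.
have dis' (i j : 'I_#|I|) : i != j -> `]l (enum_val i), r (enum_val i)[%classic
    `&` `]l (enum_val j), r (enum_val j)[%classic = set0.
  by move=> ij; apply: dis; rewrite (inj_eq enum_val_inj).
pose tag (i : 'I_#|I|) : cinterval c d :=
  exist (fun x => x \in `[c, d]%classic) _ (tcd (enum_val i)).
exists (@TaggedPartition _ c d _ (l \o enum_val) (r \o enum_val) tag
  (fun i => lr (enum_val i)) dis' cov' (fun i => tin (enum_val i))).
split=> [g fg i|phi]; first exact: fg.
rewrite /partition_sum /= [RHS](reindex_onto enum_val enum_rank)/=; last first.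
  by move=> i _; exact: enum_rankK.
by apply: eq_big => [i|i _//]; rewrite enum_valK eqxx.
Qed.

Lemma tp_subset c d (D : tagged_partition c d) (i : 'I_(tp_size D)) :
  `[tp_left i, tp_right i]%classic `<=` `[c, d]%classic.
Proof. by move=> x xi; rewrite -(tp_cover D); exists i. Qed.

Lemma trivial_partition c d g t : c < d -> `[c, d]%classic t ->
  `[c, d] `<=` `](t - g t), (t + g t)[ ->
  exists2 D : tagged_partition c d, fine_partition (fun x => g (\val x)) D &
    forall phi, partition_sum (fun x => phi (\val x)) D = phi t * (d - c).
Proof.
move=> cd tcd fg.
have [|||//|D [fD sD]] :=
  @family_partition c d unit (fun=> c) (fun=> d) (fun=> t).
- by [].
- by move=> [] [].
- by rewrite bigcup_const//; exists tt.
by exists D => [|phi]; [exact: fD|rewrite sD big_const card_unit/= addr0].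
Qed.

Lemma refine_partition a b g (D : tagged_partition a b)
    (E : forall i : 'I_(tp_size D), tagged_partition (tp_left i) (tp_right i)) :
  (forall i, fine_partition (fun x => g (\val x)) (E i)) ->
  exists2 D' : tagged_partition a b, fine_partition (fun x => g (\val x)) D' &
    forall phi, partition_sum (fun x => phi (\val x)) D' =
      \sum_i partition_sum (fun x => phi (\val x)) (E i).
Proof.
move=> fE.
pose l (k : {i : 'I_(tp_size D) & 'I_(tp_size (E i))}) := tp_left (tagged k).
pose r (k : {i : 'I_(tp_size D) & 'I_(tp_size (E i))}) := tp_right (tagged k).
pose t (k : {i : 'I_(tp_size D) & 'I_(tp_size (E i))}) :=
  \val (tp_tag (tagged k)).
have [|||//|D' [fD' sD']] := @family_partition a b _ l r t.
- by move=> k; exact: tp_nondegenerate.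
- move=> [i j] [i' j']; have [ii'|ii' _] := eqVneq i i'.
    case: _ / ii' j' => j' jj'; rewrite /l /r /=; apply: tp_nonoverlapping.
    by apply: contra_neq jj' => ->.
  apply/seteqP; split=> [x/= [xj xj']|//].
  have := tp_nonoverlapping ii' => /seteqP[/(_ x) + _]; apply.
  have sub (i0 : 'I_(tp_size D)) (j0 : 'I_(tp_size (E i0))) :
      `]tp_left j0, tp_right j0[%classic `<=`
      `]tp_left i0, tp_right i0[%classic.
    move=> y /=; rewrite !in_itv/= => /andP[ly yr].
    have jlr := tp_nondegenerate j0.
    have /= := @tp_subset _ _ (E i0) j0 (tp_left j0).
    rewrite !in_itv/= lexx (ltW jlr) => /(_ isT)/andP[h _].
    have /= := @tp_subset _ _ (E i0) j0 (tp_right j0).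
    rewrite !in_itv/= lexx (ltW jlr) => /(_ isT)/andP[_ h'].
    by rewrite (le_lt_trans h ly) (lt_le_trans yr h').
  by split; [exact: sub xj|exact: sub xj'].
- apply/seteqP; split=> x.
    move=> [[i j] _ xij]; apply: (@tp_subset _ _ D i).
    exact: (@tp_subset _ _ (E i) j).
  rewrite -[X in X x -> _](tp_cover D) => -[i _ xi].
  move: (xi); rewrite -[X in X x -> _](tp_cover (E i)) => -[j _ xj].
  by exists (Tagged (fun i => 'I_(tp_size (E i))) j).
- by move=> k; exact: tp_tag_in.
exists D' => [|phi]; first by apply: fD' => -[i j]; exact: fE.
by rewrite sD' /partition_sum sig_big_dep.
Qed.

Lemma fine_partition_cat c d e g :
  (exists D : tagged_partition c d, fine_partition (fun x => g (\val x)) D) ->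
  (exists D : tagged_partition d e, fine_partition (fun x => g (\val x)) D) ->
  c < d -> d < e ->
  exists D : tagged_partition c e, fine_partition (fun x => g (\val x)) D.
Proof.
move=> [D fD] [E fE] cd de.
pose l (k : 'I_(tp_size D) + 'I_(tp_size E)) :=
  match k with inl i => tp_left i | inr j => tp_left j end.
pose r (k : 'I_(tp_size D) + 'I_(tp_size E)) :=
  match k with inl i => tp_right i | inr j => tp_right j end.
pose t (k : 'I_(tp_size D) + 'I_(tp_size E)) :=
  match k with inl i => \val (tp_tag i) | inr j => \val (tp_tag j) end.
have disDE (i : 'I_(tp_size D)) (j : 'I_(tp_size E)) :
    `]tp_left i, tp_right i[ `&` `]tp_left j, tp_right j[ = set0 :> set R.
  apply/seteqP; split=> [x/=|//].
  rewrite !in_itv/= => -[/andP[ix xi] /andP[jx xj]].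
  have /= := @tp_subset _ _ D i x.
  rewrite !in_itv/= (ltW ix) (ltW xi) => /(_ isT)/andP[_].
  have /= := @tp_subset _ _ E j (tp_left j).
  rewrite !in_itv/= lexx (ltW (tp_nondegenerate j)) => /(_ isT)/andP[dl _] xd.
  by have := lt_le_trans jx xd; rewrite ltNge dl.
have [|||//|F [fF _]] := @family_partition c e _ l r t.
- by move=> [i|i]; exact: tp_nondegenerate.
- move=> [i|i] [j|j] ij /=.
  + by apply: tp_nonoverlapping; apply: contra_neq ij => ->.
  + exact: disDE.
  + by rewrite setIC; exact: disDE.
  + by apply: tp_nonoverlapping; apply: contra_neq ij => ->.
- have -> : `[c, e]%classic = `[c, d] `|` `[d, e] :> set R.
    apply/seteqP; split=> x /=; rewrite !in_itv/=.
      move=> /andP[cx xe]; have [xd|dx] := leP x d; [left|right].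
        by rewrite cx.
      by rewrite xe ltW.
    move=> [/andP[cx xd]|/andP[dx xe]].
      by rewrite cx (le_trans xd)// ltW.
    by rewrite xe (le_trans _ dx)// ltW.
  rewrite -(tp_cover D) -(tp_cover E); apply/seteqP; split=> x.
    by move=> [[i|i] _ xi]; [left|right]; exists i.
  by move=> [] [i _ xi]; [exists (inl i)|exists (inr i)].
- by move=> [i|i]; exact: tp_tag_in.
by exists F; apply: fF => -[i|i]; [exact: fD|exact: fE].
Qed.

(** Supremum argument: the supremum [s] of the points reached by fine partitions can itself be a
    tag, and its gauge interval carries a partition beyond [s] unless [s = d]. *)
Lemma cousin c d g : (forall x, 0 < g x) -> c < d ->
  exists D : tagged_partition c d, fine_partition (fun x => g (\val x)) D.
Proof.
move=> g0 cd.
pose S := [set x | c <= x <= d /\ (x = c \/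
  exists D : tagged_partition c x, fine_partition (fun x => g (\val x)) D)].
have Sc : S c by split; [rewrite lexx ltW|left].
have ubS : has_ubound S by exists d => x [/andP[]].
have supS : has_sup S by split=> //; exists c.
have := @sup_adherent _ S _ (g0 (sup S)) supS; set s := sup S.
move=> [x Sx sx].
have xs : x <= s by exact: ub_le_sup Sx.
have sd : s <= d by apply: ge_sup; [exists c|move=> y [/andP[]]].
(* Since [s - g s < x] and [y < s + g s], the interval [[x, y]] with tag [s] is fine; moreover
   [s < y] unless [y = d]. *)
pose y := Num.min d (s + g s / 2).
have gs := g0 s.
have sy : s <= y by rewrite le_min sd/=; lra.
have [cx xd] := andP Sx.1.
have Sy : S y.
  have [xy|yx] := ltP x y; last first.
    have -> : y = x by apply/le_anti; rewrite yx (le_trans xs sy).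
    exact: Sx.
  split; first by rewrite /y ge_min lexx andbT -/y; lra.
  right; have [D fD _] : exists2 D : tagged_partition x y,
      fine_partition (fun x => g (\val x)) D &
      forall phi, partition_sum (fun x => phi (\val x)) D = phi s * (y - x).
    apply: trivial_partition => //; first by rewrite /= in_itv/= xs sy.
    move=> z /=; rewrite !in_itv/= => /andP[xz zy].
    have : y <= s + g s / 2 by rewrite /y ge_min lexx orbT.
    by move=> ys; apply/andP; split; lra.
  have [xc|xc] := eqVneq x c; first by rewrite -xc; exists D.
  apply: (@fine_partition_cat c x y) => //; last by rewrite lt_neqAle eq_sym xc.
    by case: Sx => _ [xc'|//]; rewrite xc' eqxx in xc.
  by exists D.
have ys : y <= s by exact: ub_le_sup Sy.
have yd : y = d.
  have [ds|/ltW sd'] := leP d (s + g s / 2); first by rewrite /y min_l.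
  by exfalso; move: ys; rewrite /y min_r//; lra.
by move: Sy; rewrite yd => -[_ [dc|//]]; rewrite dc ltxx in cd.
Qed.

End Partitions.

(** * Bounds on Riemann sums over fine partitions *)

Section SumBounds.
Context {R : realType}.
Variables a b : R.
Implicit Types (delta phi psi : cinterval a b -> R).

(** Carries data on [[a, b]] to the line, where [cousin] and [refine_partition] work. The default
    [y] is 1 for gauges, to keep them positive, and 0 for integrands. *)
Definition extend (y : R) (delta : cinterval a b -> R) (x : R) : R :=
  if insub x is Some t then delta t else y.

Lemma extend_val y delta t : extend y delta (\val t) = delta t.
Proof. by rewrite /extend valK. Qed.

(** Keep the intervals in [A] with their tags and replace every other one by a fine partition from
    Cousin's lemma. The result is [delta]-fine, and the terms added to the sum are nonnegative. *)
Lemma ler_subpartition_sum delta phi C (D : tagged_partition a b)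
    (A : pred 'I_(tp_size D)) :
  (forall t, 0 <= phi t) -> gauge delta ->
  (forall D', fine_partition delta D' -> partition_sum phi D' <= C) ->
  (forall i : 'I_(tp_size D), A i -> `[tp_left i, tp_right i] `<=`
    `](\val (tp_tag i) - delta (tp_tag i)),
      (\val (tp_tag i) + delta (tp_tag i))[) ->
  \sum_(i | A i) phi (tp_tag i) * (tp_right i - tp_left i) <= C.
Proof.
move=> phi0 gdelta bnd fA.
pose g := extend 1 delta; pose psi := extend 0 phi.
have g0 x : 0 < g x.
  by rewrite /g /extend; case: insub => [t|]; [exact: gdelta|exact: ltr01].
have psi0 x : 0 <= psi x by rewrite /psi /extend; case: insub.
have extE (y : R) (f : cinterval a b -> R) :
  (fun x : cinterval a b => extend y f (\val x)) = f.
  by apply/funext => t; rewrite extend_val.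
have H (i : 'I_(tp_size D)) :
    exists E : tagged_partition (tp_left i) (tp_right i),
    fine_partition (fun x => g (\val x)) E /\
    (A i -> phi (tp_tag i) * (tp_right i - tp_left i) <=
       partition_sum (fun x => psi (\val x)) E).
  have [Ai|nAi] := boolP (A i); last first.
    by have [E fE] := cousin g0 (tp_nondegenerate i); exists E.
  have [||E fE sE] := @trivial_partition _ _ _ g (\val (tp_tag i))
      (tp_nondegenerate i).
  - exact: tp_tag_in.
  - by rewrite /g extend_val; exact: fA.
  by exists E; split=> // _; rewrite sE /psi extend_val.
pose E i := projT1 (cid (H i)).
have HE i := projT2 (cid (H i)).
have [D' fD' sD'] := @refine_partition _ _ _ g D E (fun i => (HE i).1).
have := sD' psi; rewrite extE => sD''.
rewrite /g extE in fD'.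
apply: le_trans (bnd _ fD'); rewrite sD'' [leLHS]big_mkcond/=.
apply: ler_sum => i _; case: ifPn => [Ai|_]; first exact: (HE i).2.
exact: partition_sum_ge0.
Qed.

(** [pmean_bounded] for an arbitrary integrand, so that linear combinations of p-th powers are
    covered. *)
Definition sums_bounded phi C := exists2 delta, gauge delta &
  forall D, fine_partition delta D -> partition_sum phi D <= C.

Lemma sums_bounded_le phi psi C C' : (forall t, psi t <= phi t) -> C <= C' ->
  sums_bounded phi C -> sums_bounded psi C'.
Proof.
move=> le_psi CC' [delta gdelta bnd]; exists delta => // D /bnd bD.
exact: le_trans (ler_partition_sum D le_psi) (le_trans bD CC').
Qed.

Lemma sums_boundedZ c phi C : 0 <= c ->
  sums_bounded phi C -> sums_bounded (fun t => c * phi t) (c * C).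
Proof.
move=> c0 [delta gdelta bnd]; exists delta => // D /bnd bD.
by rewrite partition_sumZ ler_wpM2l.
Qed.

Lemma sums_bounded_sum (phi : nat -> cinterval a b -> R) (C : nat -> R) n :
  (forall j, (j < n)%N -> sums_bounded (phi j) (C j)) ->
  sums_bounded (fun t => \sum_(j < n) phi j t) (\sum_(j < n) C j).
Proof.
elim: n => [|n IHn] bnd.
  exists (fun=> 1) => [t//|D _]; rewrite big_ord0 /partition_sum big1// => i _.
  by rewrite big_ord0 mul0r.
have [|d gd bd] := IHn; first by move=> j jn; apply: bnd; exact: ltnW.
have [d' gd' bd'] := bnd n (ltnSn n).
exists (fun t => Num.min (d t) (d' t)) => [t|D].
  by rewrite lt_min gd gd'.
move=> /fine_partition_min[/bd h /bd' h'].
have -> : (fun t => \sum_(j < n.+1) phi j t) =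
    (fun t => \sum_(j < n) phi j t + phi n t).
  by apply/funext => t; rewrite big_ord_recr.
by rewrite partition_sumD big_ord_recr lerD.
Qed.

(** Countable subadditivity by a diagonal gauge: at [t], use the gauge of a [phi k] that dominates
    [psi] there. Grouping a fine partition by [k] gives subfamilies to which [ler_subpartition_sum]
    applies. *)
Lemma sums_bounded_countable psi (phi : nat -> cinterval a b -> R)
    (C : nat -> R) B :
  (forall k t, 0 <= phi k t) -> (forall k, sums_bounded (phi k) (C k)) ->
  (forall t, exists k, psi t <= phi k t) ->
  (forall n, \sum_(k < n) C k <= B) -> sums_bounded psi B.
Proof.
move=> phi0 bnd /choice[k psi_le] CB.
have /choice[delta Hd] (n : nat) : exists delta, gauge delta /\
    forall D, fine_partition delta D -> partition_sum (phi n) D <= C n.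
  by have [d gd bd] := bnd n; exists d.
exists (fun t => delta (k t) t) => [t|D fD]; first exact: (Hd _).1.
(* A partition has finitely many tags, so only indices below [N] occur. *)
pose N := (\max_(i < tp_size D) k (tp_tag i)).+1.
have kN (i : 'I_(tp_size D)) : (k (tp_tag i) < N)%N.
  by rewrite ltnS; exact: (leq_bigmax (F := fun i => k (tp_tag i))).
apply: le_trans (CB N).
apply: (@le_trans _ _ (\sum_(i < tp_size D)
    \sum_(n < N | n == k (tp_tag i) :> nat)
    phi n (tp_tag i) * (tp_right i - tp_left i))).
  apply: ler_sum => i _; rewrite (big_pred1 (Ordinal (kN i)))//=.
    by rewrite ler_wpM2r// subr_ge0 ltW// tp_nondegenerate.
rewrite (exchange_big_dep predT)//=; apply: ler_sum => n _.
apply: (@ler_subpartition_sum (delta n)) => //.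
- exact: (Hd n).1.
- exact: (Hd n).2.
by move=> i /eqP ->; exact: fD.
Qed.

End SumBounds.

(** * Semi-norm inequalities and geometric increments *)

Section Seminorms.
Context {R : realType} (V : lmodType R) (q : V -> R) (sq : seminorm q).

Lemma seminorm0 : q 0 = 0.
Proof. by case: sq => _ _ qZ; rewrite -(scale0r 0) qZ normr0 mul0r. Qed.

Lemma seminormBC x y : q (x - y) = q (y - x).
Proof.
case: sq => _ _ qZ.
by rewrite -[in LHS]opprB -[in LHS]scaleN1r qZ normrN1 mul1r.
Qed.

Lemma seminormB_triangle y x z : q (x - z) <= q (x - y) + q (y - z).
Proof.
case: sq => _ qD _.
by rewrite -[x in q (x - z)](subrK y) -addrA; exact: qD.
Qed.

Lemma seminorm_geometric (g : nat -> V) (y : R) m : 0 <= y ->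
  (forall k, (m <= k)%N -> q (g k.+1 - g k) <= y / 2 ^+ k.+2) ->
  forall n, (m <= n)%N -> q (g n - g m) <= y / 2 ^+ m.+1.
Proof.
move=> y0 step n mn; have h (k : nat) : 0 < (2 : R) ^+ k by rewrite exprn_gt0.
(* The right-hand side is the exact partial sum of the geometric series, a form that passes through
   the induction. *)
suff : q (g n - g m) <= y / 2 ^+ m.+1 - y / 2 ^+ n.+1.
  by move/le_trans; apply; rewrite gerBl divr_ge0// ltW.
rewrite -(subnKC mn); elim: (n - m)%N => [|j IHj].
  by rewrite addn0 !subrr seminorm0.
apply: le_trans (seminormB_triangle (g (m + j)%N) _ _) _.
rewrite addnS; have := step (m + j)%N (leq_addr _ _).
have E : y / 2 ^+ (m + j).+1 =
    y / 2 ^+ (m + j).+2 + y / 2 ^+ (m + j).+2; last lra.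
by rewrite (exprS _ (m + j).+1); field; rewrite gt_eqF.
Qed.

End Seminorms.

Lemma div_exp2_lt (R : realType) (y e : R) : 0 < e ->
  exists N, forall n, (N <= n)%N -> y / 2 ^+ n < e.
Proof.
move=> e0; have ye : 0 <= `|y| / e by rewrite divr_ge0// ltW.
exists (Num.bound (`|y| / e)) => n Nn.
rewrite ltr_pdivrMr ?exprn_gt0// mulrC -ltr_pdivrMr//.
apply: (@le_lt_trans _ _ (`|y| / e)).
  by rewrite ler_pM2r ?invr_gt0// ler_norm.
apply: lt_le_trans (archi_boundP ye) _.
by rewrite -natrX ler_nat (leq_trans Nn)// ltnW// ltn_expl.
Qed.

(** * Topology generated by a sequence of semi-norms, and pointwise limits *)

Section GeneratedTopology.
Context {R : realType} (Y : preTopologicalLmodType R) (rho : nat -> Y -> R).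
Hypothesis rho_sn : forall i, seminorm (rho i).
Hypothesis rho_gen : generates (range rho).

Lemma generates_ball x U : open U -> U x ->
  exists (N : nat) (e : R), 0 < e /\
    forall y, (forall i, (i < N)%N -> rho i (y - x) < e) -> U y.
Proof.
rewrite rho_gen => oU /oU[F [e [finF FP e0 FU]]].
(* Each member of [F] is some [rho i]; index 0 is a filler outside [F]. Finiteness of [F] bounds the
   indices used. *)
have /choice[idx Hidx] (r : Y -> R) : exists i, F r -> rho i = r.
  have [/FP[i _ <-]|] := pselect (F r); first by exists i.
  by exists 0%N.
have /finite_seqP[s sE] := finite_image idx finF.
exists (\max_(i <- s) i).+1, e; split=> // y small.
apply: FU => r Fr; rewrite -(Hidx r Fr); apply: small.
have : [set` s] (idx r) by rewrite -sE; exists r.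
by move=> /= rs; rewrite ltnS; exact: leq_bigmax_seq.
Qed.

Lemma open_seminorm_ball i x (e : R) : open [set y | rho i (y - x) < e].
Proof.
rewrite rho_gen => y /= ye.
exists [set rho i], (e - rho i (y - x)); split=> //.
- by move=> _ ->; exists i.
- by rewrite subr_gt0.
move=> z /= /(_ _ erefl) zy.
apply: le_lt_trans (seminormB_triangle (rho_sn i) y _ _) _; lra.
Qed.

Lemma generating_continuous i : continuous (rho i).
Proof.
move=> x; apply/cvgrPdist_lt => e e0.
have : nbhs x [set y | rho i (y - x) < e].
  apply: open_nbhs_nbhs; split; first exact: open_seminorm_ball.
  by rewrite /= subrr seminorm0.
apply: filterS => y /= yx; rewrite ltr_norml; apply/andP.
have := seminormB_triangle (rho_sn i) x y 0.
have := seminormB_triangle (rho_sn i) y x 0.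
by rewrite !subr0 (seminormBC (rho_sn i) x) => ? ?; split; lra.
Qed.

Lemma cvg_seminormsP (u : nat -> Y) x : u @ \oo --> x <->
  forall i (e : R), 0 < e ->
    exists N, forall n, (N <= n)%N -> rho i (u n - x) < e.
Proof.
split=> [ux i e e0|H].
  have : nbhs x [set y | rho i (y - x) < e].
    apply: open_nbhs_nbhs; split; first exact: open_seminorm_ball.
    by rewrite /= subrr seminorm0.
  by move/ux => [N _ HN]; exists N => n Nn; exact: HN.
move=> U; rewrite nbhsE => -[W [oW Wx] WU].
have [N [e [e0 HW]]] := generates_ball oW Wx.
have /choice[M HM] (i : nat) := H i e e0.
exists (\max_(i < N) M i)%N => // n /= Mn; apply/WU/HW => i iN.
apply: HM; apply: leq_trans Mn.
exact: (leq_bigmax (F := fun i : 'I_N => M i) (Ordinal iN)).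
Qed.

(** Continuity at 0 puts a ball of finitely many [rho i] inside the set where [q < 1]. If the bound
    failed at [x], then [(q x)^-1 *: x] would lie in this ball, although [q] equals 1 there. *)
Lemma continuous_seminorm_dominated q : continuous_seminorm q ->
  exists (N : nat) (C : R), 0 <= C /\ forall x, q x <= C * \sum_(i < N) rho i x.
Proof.
move=> [sq cq]; have [q0 _ qZ] := sq.
have [N [e [e0 H]]] : exists (N : nat) (e : R), 0 < e /\
    forall y, (forall i, (i < N)%N -> rho i (y - 0) < e) -> q y < 1.
  apply: (@generates_ball 0 [set x | q x < 1]); last by rewrite /= seminorm0.
  by move/continuousP : cq => /(_ _ (@open_lt _ 1)).
exists N, (2 / e); split=> [|x]; first by rewrite divr_ge0// ltW.
have S0 : 0 <= \sum_(i < N) rho i x.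
  by apply: sumr_ge0 => i _; case: (rho_sn i).
rewrite leNgt; apply/negP => lt_q.
have qx0 : 0 < q x.
  by apply: le_lt_trans lt_q; rewrite mulr_ge0// divr_ge0// ltW.
have : q ((q x)^-1 *: x) < 1.
  apply: H => i iN; have [_ _ riZ] := rho_sn i.
  rewrite subr0 riZ ger0_norm ?invr_ge0// mulrC ltr_pdivrMr//.
  have : rho i x <= \sum_(i < N) rho i x.
    rewrite (bigD1 (Ordinal iN))//= lerDl sumr_ge0// => j _.
    by case: (rho_sn j).
  move: lt_q; rewrite mulrAC ltr_pdivrMr// mulrC [X in _ < X]mulrC.
  by move: S0; lra.
by rewrite qZ ger0_norm ?invr_ge0// mulVf ?gt_eqF// ltxx.
Qed.

(** Sequential completeness asks for the Cauchy condition in all continuous semi-norms; this reduces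
    it to the [rho i]. *)
Lemma cauchy_dominated (u : nat -> Y) :
  (forall i, seminorm_cauchy (rho i) u) ->
  forall q, continuous_seminorm q -> seminorm_cauchy q u.
Proof.
move=> cu q /continuous_seminorm_dominated[N [C [C0 qC]]] e e0.
(* The summand 1 keeps the divisor positive when [C] or [N] is 0 and makes the final estimate
   strict. *)
have CN0 : 0 < C * N%:R + 1 by rewrite ltr_wpDl// mulr_ge0.
have d0 : 0 < e / (C * N%:R + 1) by rewrite divr_gt0.
have /choice[M HM] (i : nat) := cu i _ d0.
exists (\max_(i < N) M i)%N => m n Mm Mn.
apply: le_lt_trans (qC _) _.
apply: (@le_lt_trans _ _ (C * \sum_(i < N) (e / (C * N%:R + 1)))).
  rewrite ler_wpM2l//; apply: ler_sum => i _; apply: ltW.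
  have Mi : (M i <= \max_(i < N) M i)%N.
    exact: (leq_bigmax (F := fun i : 'I_N => M i) i).
  by apply: HM; exact: leq_trans Mi _.
have -> : C * \sum_(i < N) (e / (C * N%:R + 1)) =
    e * (C * N%:R / (C * N%:R + 1)).
  by rewrite sumr_const card_ord -mulr_natr; ring.
by rewrite -[ltRHS]mulr1 ltr_pM2l// ltr_pdivrMr// mul1r ltrDl.
Qed.

(* [x] is the limit of [g] if [g] converges, and [0] otherwise; in that case
   [j] is such that [g] is not [rho j]-Cauchy. Increments eventually below
   [rho i (x - g m) / 2 ^+ k.+2] are impossible in both cases. *)
Lemma pointwise_limit (g : nat -> Y) : sequentially_complete Y ->
  exists x, forall i m, exists k j,
    (m <= k)%N /\ ((i <= m)%N -> (j <= k)%N) /\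
    rho i (x - g m) <= 2 ^+ k.+2 * rho j (g k.+1 - g k).
Proof.
move=> scY; have h (k : nat) : 0 < (2 : R) ^+ k by rewrite exprn_gt0.
have [cg|] := pselect (forall i, seminorm_cauchy (rho i) g).
  have [x gx] := scY g (cauchy_dominated cg); exists x => i m.
  suff [k [mk kle]] : exists k, (m <= k)%N /\
      rho i (x - g m) <= 2 ^+ k.+2 * rho i (g k.+1 - g k).
    by exists k, i; split=> //; split=> // im; exact: leq_trans mk.
  (* Otherwise the increments from [m] on are below [y / 2 ^+ k.+2] and add up to at most [y / 2].
     As [g] comes within [y / 2] of [x], the triangle inequality gives [y < y]. *)
  apply: contrapT => /forallNP small; set y := rho i (x - g m) in small.
  have {}small k : (m <= k)%N -> 2 ^+ k.+2 * rho i (g k.+1 - g k) < y.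
    by move=> mk; rewrite ltNge; apply/negP => ky; apply: (small k).
  have y0 : 0 < y.
    apply: le_lt_trans (small m (leqnn m)).
    by apply: mulr_ge0; [exact/ltW/h|case: (rho_sn i)].
  have [N HN] := (cvg_seminormsP g x).1 gx i (y / 2) (divr_gt0 y0 (ltr0Sn _ 1)).
  have := HN (maxn N m) (leq_maxl _ _).
  have geo : rho i (g (maxn N m) - g m) <= y / 2 ^+ m.+1.
    apply: (seminorm_geometric (rho_sn i) (ltW y0)); last exact: leq_maxr.
    by move=> k /small/ltW; rewrite ler_pdivlMr// mulrC.
  have half : y / 2 ^+ m.+1 <= y / 2.
    rewrite ler_pM2l// lef_pV2 ?posrE// exprS.
    by rewrite ler_peMr// exprn_ege1// ler1n.
  have := seminormB_triangle (rho_sn i) (g (maxn N m)) x (g m).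
  by rewrite -/y (seminormBC (rho_sn i) x) => ? ?; lra.
move=> /existsNP[j ncj]; exists 0 => i m.
suff [k [mk kle]] : exists k, (maxn m j <= k)%N /\
    rho i (0 - g m) <= 2 ^+ k.+2 * rho j (g k.+1 - g k).
  exists k, j; split; first exact: leq_trans (leq_maxl _ _) mk.
  by split=> // _; exact: leq_trans (leq_maxr _ _) mk.
(* Otherwise the [rho j]-increments are eventually dominated by a geometric sequence, which makes
   [g] Cauchy for [rho j]. Starting at [maxn m j] secures both [m <= k] and [j <= k]. *)
apply: contrapT => /forallNP small; apply: ncj; set y := rho i _ in small.
have {}small k : (maxn m j <= k)%N -> 2 ^+ k.+2 * rho j (g k.+1 - g k) <= y.
  by move=> mk; apply: ltW; rewrite ltNge; apply/negP => ky; apply: (small k).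
have y0 : 0 <= y by rewrite /y; case: (rho_sn i).
move=> e e0; have [N HN] := div_exp2_lt y e0.
pose M := maxn N (maxn m j); exists M => n n' Mn Mn'.
have geo (l : nat) : (M <= l)%N -> rho j (g l - g M) <= y / 2 ^+ M.+1.
  move=> Ml; apply: (seminorm_geometric (rho_sn j) y0) Ml => k Mk.
  have /small : (maxn m j <= k)%N by exact: leq_trans (leq_maxr _ _) Mk.
  by rewrite ler_pdivlMr// mulrC.
apply: le_lt_trans (HN M (leq_maxl _ _)).
apply: le_trans (seminormB_triangle (rho_sn j) (g M) _ _) _.
have -> : y / 2 ^+ M = y / 2 ^+ M.+1 + y / 2 ^+ M.+1.
  by rewrite exprS; field; rewrite gt_eqF.
by rewrite (seminormBC (rho_sn j) (g M)) lerD// geo.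
Qed.

End GeneratedTopology.

(** The sum is at most [n] times its largest term, whose p-th power is one of the terms on the
    right. *)
Lemma powR_sum_le (R : realType) (p : R) n (x : 'I_n -> R) : 1 <= p ->
  (forall i, 0 <= x i) ->
  (\sum_i x i) `^ p <= n%:R `^ p * \sum_i x i `^ p.
Proof.
move=> p1 x0; have p0 : 0 < p by exact: lt_le_trans p1.
case: n x x0 => [|n] x x0; first by rewrite !big_ord0 powR0 ?gt_eqF// mulr0.
case: (@arg_maxP _ _ _ ord0 predT x isT) => k _ kmax.
apply: (@le_trans _ _ ((n.+1%:R * x k) `^ p)).
  apply: ge0_ler_powR; rewrite ?(ltW p0) ?nnegrE ?sumr_ge0 ?mulr_ge0//.
  rewrite mulr_natl -[n.+1 in leRHS]card_ord -sumr_const.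
  by apply: ler_sum => i _; exact: kmax.
rewrite powRM// ler_wpM2l ?powR_ge0//.
by rewrite (bigD1 k)//= lerDl sumr_ge0// => i _; exact: powR_ge0.
Qed.

(** * Limits of functions in the upper p-mean *)

Section Limit.
Context {R : realType}.
Variables (a b : R) (X : preTopologicalLmodType R) (p : R).
Hypothesis scX : sequentially_complete X.
Variables (rho : nat -> X -> R) (rhoP : fundamental_seminorms rho).
Hypothesis p1 : 1 <= p.

Let p0 : 0 < p. Proof. exact: lt_le_trans p1. Qed.
Let rho_cont i : continuous_seminorm (rho i). Proof. by case: rhoP. Qed.
Let rho_sn i : seminorm (rho i). Proof. by case: (rho_cont i). Qed.
Let rho_gen : generates (range rho). Proof. by case: rhoP. Qed.

(** A continuous semi-norm is dominated by a multiple of a finite sum of the [rho i], and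
    [powR_sum_le] passes this to p-th powers. *)
Lemma UpfiniteP (f : cinterval a b -> X) :
  (forall i, (upper_pmean (rho i) p f < +oo)%E) -> f \in Upfinite p1.
Proof.
move=> ff; apply/asboolP => q cq; have [sq _] := cq.
have [N [C [C0 qC]]] := continuous_seminorm_dominated rho_sn rho_gen cq.
have /choice[B HB] (i : nat) : exists B : R,
    sums_bounded (fun t => rho i (f t) `^ p) B.
  have := ff i; case E : (upper_pmean (rho i) p f) => [r| |] _//.
    by exists (r + 1); apply: upper_pmean_bounded; rewrite E lte_fin ltrDl.
  (* The value [-oo] arises when some gauge has no fine partition, as happens for [a = b]. *)
  by exists 0; apply: upper_pmean_bounded; rewrite E ltNyr.
have HS := sums_bounded_sum (fun j (_ : (j < N)%N) => HB j).
have K0 : 0 <= C `^ p * N%:R `^ p by rewrite mulr_ge0 ?powR_ge0.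
apply: le_lt_trans (ltry _).
apply: (@bounded_upper_pmean _ _ _ _ _ _ _ _).
apply: (sums_bounded_le _ (lexx _) (sums_boundedZ K0 HS)) => t /=.
have [q0 _ _] := sq.
have S0 : 0 <= \sum_(i < N) rho i (f t).
  by apply: sumr_ge0 => i _; case: (rho_sn i).
apply: (@le_trans _ _ ((C * \sum_(i < N) rho i (f t)) `^ p)).
  by apply: ge0_ler_powR; rewrite ?(ltW p0) ?nnegrE// mulr_ge0.
rewrite powRM// -mulrA ler_wpM2l ?powR_ge0//.
by apply: powR_sum_le => // i; case: (rho_sn i).
Qed.

(* The factor [k.+1] is the number of semi-norms [rho j] with [j <= k], and
   [(2 ^+ k.+2) `^ p] is the loss in [pointwise_limit]. *)
Let B (k : nat) : R := ((2 ^+ k * k.+1%:R) * (2 ^+ k.+2) `^ p)^-1.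

(** The function [f] is chosen pointwise before [i] and [m], so it serves all semi-norms at once.
    The condition [i <= m] yields [j <= k] in [pointwise_limit], the range in which increments are
    controlled. *)
Lemma exists_pmean_limit (F : nat -> cinterval a b -> X) :
  (forall k j, (j <= k)%N ->
     sums_bounded (fun t => rho j (F k.+1 t - F k t) `^ p) (B k)) ->
  exists f : cinterval a b -> X, forall i m, (i <= m)%N ->
    sums_bounded (fun t => rho i (f t - F m t) `^ p) (2 / 2 ^+ m).
Proof.
move=> FB; have h (k : nat) : 0 < (2 : R) ^+ k by rewrite exprn_gt0.
have /choice[f Hf] (t : cinterval a b) :=
  pointwise_limit rho_sn rho_gen (fun k => F k t) scX.
exists f => i m im.
(* Here [m + n] stands for the selected [k], and summing over all [j <= k] covers the unknown [j].
   By the choice of [B], the Riemann sums of [phi n] are bounded by [1 / 2 ^+ k]. *)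
pose phi n (t : cinterval a b) := (2 ^+ (m + n).+2) `^ p *
  \sum_(j < (m + n).+1) rho j (F (m + n).+1 t - F (m + n)%N t) `^ p.
apply: (@sums_bounded_countable _ _ _ _ phi (fun n => (2 ^+ (m + n))^-1)).
- move=> n t; apply: mulr_ge0; first exact: powR_ge0.
  by apply: sumr_ge0 => j _; exact: powR_ge0.
- move=> n; have HS := sums_bounded_sum
    (fun j (jmn : (j < (m + n).+1)%N) => FB (m + n)%N j jmn).
  have := sums_boundedZ (powR_ge0 (2 ^+ (m + n).+2) p) HS.
  apply: sums_bounded_le => //.
  rewrite sumr_const card_ord -[_ *+ (m + n).+1]mulr_natr /B.
  rewrite le_eqVlt; apply/orP; left; apply/eqP.
  have : (2 ^+ (m + n).+2 : R) `^ p != 0 by rewrite gt_eqF// powR_gt0.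
  have := lt0r_neq0 (h (m + n)%N); have : (m + n).+1%:R != 0 :> R by [].
  move: ((2 ^+ (m + n).+2) `^ p) (2 ^+ (m + n)) ((m + n).+1%:R).
  move=> x y z z0 y0 x0.
  by field; rewrite z0 y0 x0.
- move=> t; have [k [j [mk [/(_ im) jk le_k]]]] := Hf t i m.
  have [r0 _ _] := rho_sn i; have [rj0 _ _] := rho_sn j.
  exists (k - m)%N; rewrite /phi subnKC//.
  apply: (@le_trans _ _ ((2 ^+ k.+2 * rho j (F k.+1 t - F k t)) `^ p)).
    apply: ge0_ler_powR; rewrite ?(ltW p0) ?nnegrE//.
    by apply: mulr_ge0 => //; exact: ltW.
  rewrite powRM ?(ltW (h _))// ler_wpM2l ?powR_ge0//.
  have jk1 : (j < k.+1)%N by [].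
  rewrite (bigD1 (Ordinal jk1))//= lerDl sumr_ge0// => l _.
  exact: powR_ge0.
move=> n.
suff -> : \sum_(k < n) (2 ^+ (m + k))^-1 = 2 / 2 ^+ m - 2 / 2 ^+ (m + n) :> R.
  by rewrite gerBl divr_ge0// ltW.
elim: n => [|n IHn]; first by rewrite big_ord0 addn0 subrr.
rewrite big_ord_recr IHn /= addnS (exprS _ (m + n)).
by field; rewrite !gt_eqF.
Qed.

(** * The quotient space: semi-norms, separation and completeness *)

Section Norm.
Notation U := (Upspace a b rhoP p1).
Notation nrm := (@Upspace_norm R a b X p rho rhoP p1).

Lemma Upspace_norm_seminorm i : seminorm (nrm i).
Proof.
have repB (x : U) : exists f, x = Upclass rhoP f by exact: Upclass_surj.
have fin (f : Upfun a b X p1) := upfun_finite f (rho_cont i).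
have leZ c (x : U) : nrm i (c *: x) <= `|c| * nrm i x.
  have [f ->] := repB x; rewrite -[c *: _]UpclassZ !Upspace_normE.
  exact: (UpnormZ_le p1 (rho_sn i) c (fin f)).2.
split=> [x|x y|c x]; first exact: Upnorm_ge0.
  have [f ->] := repB x; have [g ->] := repB y.
  rewrite -UpclassD !Upspace_normE.
  exact: (UpnormD p1 (rho_sn i) (fin f) (fin g)).2.
(* The reverse inequality is [leZ] for the scalar [c^-1] and the vector [c *: x]. *)
apply/le_anti; rewrite leZ/=.
have [->|c0] := eqVneq c 0.
  by rewrite normr0 mul0r; exact: Upnorm_ge0.
rewrite mulrC -ler_pdivlMr ?normr_gt0// mulrC -normfV.
by have := leZ c^-1 (c *: x); rewrite scalerA (mulVf c0) scale1r.
Qed.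

Lemma Upspace_normB i (f g : Upfun a b X p1) :
  nrm i (Upclass rhoP f - Upclass rhoP g) =
    Upnorm (rho i) p (fun t => f t - g t).
Proof.
have -> : Upclass rhoP f - Upclass rhoP g = Upclass rhoP (f - g).
  by apply/eqP; rewrite subr_eq -UpclassD subrK.
by rewrite Upspace_normE.
Qed.

Lemma Upspace_generates : generates (range nrm).
Proof. by []. Qed.

Lemma Upspace_continuous_seminorm i : continuous_seminorm (nrm i).
Proof.
split; first exact: Upspace_norm_seminorm.
exact: (generating_continuous Upspace_norm_seminorm Upspace_generates).
Qed.

Lemma Upspace_frechet : frechet_space U.
Proof.
have cP : range nrm `<=` @continuous_seminorm R U.
  by move=> _ [i _ <-]; exact: Upspace_continuous_seminorm.
split; last first.
  exists (range nrm); split; [|exact: cP|].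
    exact: sub_countable (card_image_le _ _) (countableP _).
  exact: Upspace_generates.
split; first by exists (range nrm) => [_ /cP[]//|]; exact: Upspace_generates.
(* Separation comes from the quotient: if all norms vanish at the class of [f], then [f] lies in
   [Upnull] and its class is 0. *)
exists (range nrm) => // x x0; apply: contrapT => H.
have [f xf] : exists f, x = Upclass rhoP f by exact: Upclass_surj.
move/eqP: x0; apply; have -> : 0 = Upclass rhoP (0 : Upfun a b X p1) :> U.
  by apply: (addIr (Upclass rhoP 0)); rewrite -UpclassD !add0r.
rewrite xf; apply/Upclass_eqP; rewrite subr0; apply/asboolP => i.
apply: contrapT => /eqP ni; apply: H; exists (nrm i); first by exists i.
by rewrite xf Upspace_normE.
Qed.

Lemma Upspace_complete : sequentially_complete U.
Proof.
move=> u cu.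
have B0 k : 0 < B k.
  rewrite invr_gt0; apply: mulr_gt0; last by rewrite powR_gt0// exprn_gt0.
  by rewrite mulr_gt0 ?exprn_gt0.
have powRVK (x : R) : 0 <= x -> (x `^ p^-1) `^ p = x.
  by move=> x0; rewrite -powRrM mulVf ?gt_eqF// powRr1.
(* The p-th root turns the norm estimate into the bound [B k] on sums of p-th powers. *)
have /choice[N HN] (jk : nat * nat) : exists N : nat, forall m n,
    (N <= m)%N -> (N <= n)%N -> nrm jk.1 (u m - u n) < B jk.2 `^ p^-1.
  by apply: (cu _ (Upspace_continuous_seminorm jk.1)); exact: powR_gt0.
(* [s k] passes all thresholds with both indices at most [k], so [s k] and [s k.+1] both pass
   [N (j, k)] for [j <= k]. The summand [k] makes [s] unbounded. *)
pose s k := (k + \max_(j < k.+1) \max_(l < k.+1) N (val j, val l))%N.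
have Ns j k l : (j <= l)%N -> (k <= l)%N -> (N (j, k) <= s l)%N.
  rewrite -ltnS -(ltnS k) => jl kl; apply: leq_trans (leq_addl _ _).
  apply: leq_trans (leq_bigmax (F := fun j : 'I_l.+1 =>
    (\max_(l0 < l.+1) N (val j, val l0))%N) (Ordinal jl)).
  exact: (leq_bigmax (F := fun k : 'I_l.+1 => N (j, val k)) (Ordinal kl)).
have /choice[F HF] (k : nat) : exists f, u (s k) = Upclass rhoP f.
  exact: Upclass_surj.
have [|f Hf] := @exists_pmean_limit (fun k => upfun_val (F k)).
  move=> k j jk; rewrite -(powRVK _ (ltW (B0 k))).
  apply: (@Upnorm_bounded _ _ _ _ p1 _ (rho j) (fun t => F k.+1 t - F k t)).
    exact: (upfun_finite (F k.+1 - F k) (rho_cont j)).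
  rewrite -Upspace_normB -!HF; apply: (HN (j, k)); apply: Ns => //; exact: leqW.
have Upnorm_f i m (e : R) : (i <= m)%N -> 0 <= e -> 2 / 2 ^+ m <= e `^ p ->
    (upper_pmean (rho i) p (fun t => f t - F m t)%R < +oo)%E /\
    Upnorm (rho i) p (fun t => f t - F m t) <= e.
  move=> im e0 me; apply: bounded_Upnorm => //.
  exact: sums_bounded_le (Hf i m im).
(* For each [rho i], [f] is the sum of [f - F i] and [F i], both of finite mean. *)
have fin : f \in Upfinite p1.
  apply: UpfiniteP => i.
  have [||fin _] := Upnorm_f i i ((2 / 2 ^+ i) `^ p^-1) (leqnn i).
  - exact: powR_ge0.
  - by rewrite powRVK// divr_ge0// exprn_ge0.
  have := (UpnormD p1 (rho_sn i) fin (upfun_finite (F i) (rho_cont i))).1.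
  have -> // : (fun t => f t - F i t) + upfun_val (F i) = f.
  by apply/funext => t; exact: subrK.
exists (Upclass rhoP (UpFun fin)).
apply/(cvg_seminormsP Upspace_norm_seminorm Upspace_generates) => i e e0.
have e20 : 0 < e / 2 by rewrite divr_gt0.
have [M HM] := cu _ (Upspace_continuous_seminorm i) _ e20.
have [L HL] := div_exp2_lt 2 (powR_gt0 p e20).
(* [m] is at least [i] for the limit estimate to apply, at least [M] so that [s m] lies in the
   Cauchy tail, and at least [L] so that the distance from [F m] to [f] is at most [e / 2]. *)
pose m := maxn i (maxn M L).
exists M => n Mn.
have tri := seminormB_triangle (Upspace_norm_seminorm i).
apply: le_lt_trans (tri (u (s m)) _ _) _.
rewrite [e in ltRHS](splitr e); apply: ltr_leD.
  apply: HM => //; apply: leq_trans (leq_addr _ _).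
  by apply: leq_trans (leq_maxr _ _); exact: leq_maxl.
rewrite (seminormBC (Upspace_norm_seminorm i)) HF Upspace_normB.
apply: (Upnorm_f i m _ _ _ _).2 => //; first exact: leq_maxl.
  exact: ltW.
apply/ltW/HL; apply: leq_trans (leq_maxr _ _); exact: leq_maxr.
Qed.

End Norm.
End Limit.

Theorem theorem12 (R : realType) (a b : R) (ab : a < b)
    (X : preTopologicalLmodType R)
    (frX : frechet_space X) (scX : sequentially_complete X)
    (rho : nat -> X -> R) (rhoP : fundamental_seminorms rho)
    (p : R) (p1 : 1 <= p) :
  frechet_space (Upspace a b rhoP p1) /\
  sequentially_complete (Upspace a b rhoP p1).
Proof. by split; [exact: Upspace_frechet|exact: Upspace_complete]. Qed.
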